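(* Let $\mathbb{F}_q$ be a finite field of characteristic at least $5$, and let $K$ be a non-Galois simple cubic function field with discriminant $D(K)$ and minimal polynomial $f(x)=x^3-Ax^2-(A+b)x-c$, where $A\in\mathbb{F}_q[t]$ with $\deg(A)\ge1$, $b\in\mathbb{F}_q$, $c\in\mathbb{F}_q^*$, and with $k$-exceptional units $\varepsilon,\varepsilon+k$ ($k\in\mathbb{F}_q^*$), $\varepsilon$ being the root of $f$ of positive degree. Let $I\in\mathbb{F}_q[t]$ be the index of $\varepsilon$, i.e. $D(\varepsilon)=I^2D(K)$, and suppose $\deg(I)\le\deg(A)-1$. Then the regulator of $K$ is $R=\deg(A)^2$ and $\{\varepsilon,\varepsilon+k\}$ is a system of fundamental units of $K$.
   Context: A simple cubic function field is a cubic extension $K$ of $\mathbb{F}_q(t)$ (with full constant field $\mathbb{F}_q$) of unit rank two (the infinite place splits into three places of $K$) such that a root $\varepsilon$ of its defining polynomial is a unit of the integral closure $\mathcal{O}_K$ of $\mathbb{F}_q[t]$ with $\varepsilon\notin\mathbb{F}_q^*$, and $\varepsilon+k$ is also a unit not in $\mathbb{F}_q^*$ for some $k\in\mathbb{F}_q^*$. $D(\varepsilon)=\prod_{i<j}(\varepsilon^{(i)}-\varepsilon^{(j)})^2$ is the discriminant of $\varepsilon$, $D(K)$ the discriminant of an integral basis of $\mathcal{O}_K$. A system of fundamental units is a set of generators of $\mathcal{O}_K^*/\mathbb{F}_q^*$; with fundamental units $\varepsilon_1,\varepsilon_2$ the regulator is $R=\left|\det\begin{pmatrix}\deg\varepsilon_1^{(i)}&\deg\varepsilon_1^{(j)}\\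 \deg\varepsilon_2^{(i)}&\deg\varepsilon_2^{(j)}\end{pmatrix}\right|$ for distinct conjugates $i\neq j$, degrees taken in $\mathbb{F}_q\langle t^{-1}\rangle$. *)

(* Defs.v *)
From HB Require Import structures.
From mathcomp Require Import all_boot all_order all_algebra all_field.
From mathcomp Require Import fraction boolp.

Set Implicit Arguments.
Unset Strict Implicit.
Unset Printing Implicit Defensive.

Import GRing.Theory.
Local Open Scope ring_scope.

(** * Formal power series F[[u]] *)

Record pseries (F : fieldType) := PSeries { ps_coef : nat -> F }.

HB.instance Definition _ (F : fieldType) := gen_eqMixin (pseries F).
HB.instance Definition _ (F : fieldType) := gen_choiceMixin (pseries F).

Section PowerSeries.
Variable F : fieldType.
Implicit Types f g h : pseries F.

Lemma psP f g : ps_coef f =1 ps_coef g -> f = g.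
Proof. by case: f g => [f] [g] /= /funext ->. Qed.

Definition psC (a : F) := PSeries (fun n => if n == 0%N then a else 0).
Definition psX : pseries F := PSeries (fun n => (n == 1%N)%:R).
Definition ps_opp f := PSeries (fun n => - ps_coef f n).
Definition ps_add f g := PSeries (fun n => ps_coef f n + ps_coef g n).
Definition ps_mul f g :=
  PSeries (fun n => \sum_(i < n.+1) ps_coef f i * ps_coef g (n - i)).

Lemma ps_addA : associative ps_add.
Proof. by move=> f g h; apply: psP => n /=; rewrite addrA. Qed.
Lemma ps_addC : commutative ps_add.
Proof. by move=> f g; apply: psP => n /=; rewrite addrC. Qed.
Lemma ps_add0 : left_id (psC 0) ps_add.
Proof. by move=> f; apply: psP => n /=; rewrite if_same add0r. Qed.
Lemma ps_addN : left_inverse (psC 0) ps_opp ps_add.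
Proof. by move=> f; apply: psP => n /=; rewrite if_same addNr. Qed.

HB.instance Definition _ :=
  GRing.isZmodule.Build (pseries F) ps_addA ps_addC ps_add0 ps_addN.

Lemma ps_coefM f g n : ps_coef (ps_mul f g) n =
  \sum_(i < n.+1) ps_coef f i * ps_coef g (n - i).
Proof. by []. Qed.

Definition ps_trunc n f : {poly F} := \poly_(i < n) ps_coef f i.

Lemma coef_ps_trunc n f i : (i < n)%N -> (ps_trunc n f)`_i = ps_coef f i.
Proof. by move=> lt_in; rewrite coef_poly lt_in. Qed.

Lemma ps_mul_trunc n f g i : (i < n)%N ->
  ps_coef (ps_mul f g) i = (ps_trunc n f * ps_trunc n g)`_i.
Proof.
move=> lt_in; rewrite coefM /=; apply: eq_bigr => j _.
rewrite !coef_ps_trunc //; first exact: leq_ltn_trans (leq_subr _ _) lt_in.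
by apply: leq_trans (ltn_ord j) _.
Qed.

Lemma ps_mulA : associative ps_mul.
Proof.
move=> f g h; apply: psP => n.
transitivity ((ps_trunc n.+1 f * (ps_trunc n.+1 g * ps_trunc n.+1 h))`_n).
  rewrite ps_coefM coefM; apply: eq_bigr => j _; rewrite coef_ps_trunc ?ltn_ord //.
  by rewrite -ps_mul_trunc // ltnS leq_subr.
rewrite mulrA ps_coefM coefM; apply: eq_bigr => j _.
by rewrite (@ps_mul_trunc n.+1) ?ltn_ord // coef_ps_trunc // ltnS leq_subr.
Qed.

Lemma ps_mulC : commutative ps_mul.
Proof.
move=> f g; apply: psP => n.
by rewrite !(@ps_mul_trunc n.+1) ?ltnSn // mulrC.
Qed.

Lemma ps_mul1 : left_id (psC 1) ps_mul.
Proof.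
move=> f; apply: psP => n /=.
rewrite big_ord_recl /= mul1r subn0 big1 ?addr0 // => i _.
by rewrite mul0r.
Qed.

Lemma ps_mulDl : left_distributive ps_mul ps_add.
Proof.
move=> f g h; apply: psP => n /=; rewrite -big_split /=.
by apply: eq_bigr => i _; rewrite mulrDl.
Qed.

Lemma ps_1neq0 : psC 1 != 0 :> pseries F.
Proof.
apply/eqP => /(congr1 (fun f => ps_coef f 0)) /= /eqP.
by rewrite oner_eq0.
Qed.

HB.instance Definition _ := GRing.Zmodule_isComNzRing.Build (pseries F)
  ps_mulA ps_mulC ps_mul1 ps_mulDl ps_1neq0.

Definition ps_unit : pred (pseries F) := fun f => `[< exists g, g * f = 1 >].
Definition ps_inv f :=
  if pselect (exists g, g * f = 1) is left e then projT1 (cid e) else f.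

Lemma ps_mulV : {in ps_unit, left_inverse 1 ps_inv *%R}.
Proof.
move=> f /asboolP f_unit; rewrite /ps_inv; case: pselect => // e.
exact: (projT2 (cid e)).
Qed.
Lemma ps_unitP f g : g * f = 1 -> ps_unit f.
Proof. by move=> gf1; apply/asboolP; exists g. Qed.
Lemma ps_inv_out : {in [predC ps_unit], ps_inv =1 id}.
Proof.
move=> f; rewrite inE /= => /asboolP f_nunit.
by rewrite /ps_inv; case: pselect.
Qed.

HB.instance Definition _ := GRing.ComNzRing_hasMulInverse.Build (pseries F)
  ps_mulV ps_unitP ps_inv_out.

(** The order of vanishing at u = 0; the junk value for f = 0 is 0. *)
Definition ps_ord f : nat :=
  if pselect (exists n, ps_coef f n != 0) is left e then ex_minn e else 0.

Lemma ps_ord_spec f : f != 0 ->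
  ps_coef f (ps_ord f) != 0 /\ forall n, (n < ps_ord f)%N -> ps_coef f n = 0.
Proof.
move=> f_neq0; rewrite /ps_ord; case: pselect => [e|f0]; last first.
  case/eqP: f_neq0; apply: psP => n /=; rewrite if_same.
  by apply/eqP; apply: contra_notT f0 => fn; exists n.
case: ex_minnP => m fm min_m; split=> // n lt_nm.
by apply/eqP; apply: contraLR lt_nm => /min_m; rewrite -leqNgt.
Qed.

Lemma ps_ord_eq f n : ps_coef f n != 0 ->
  (forall m, (m < n)%N -> ps_coef f m = 0) -> ps_ord f = n.
Proof.
move=> fn fm0; have f_neq0 : f != 0.
  by apply: contraNneq fn => -> /=; rewrite if_same.
have [ford fm0'] := ps_ord_spec f_neq0.
apply/eqP; rewrite eqn_leq; apply/andP; split; rewrite leqNgt.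
  by apply: contraNN fn => /fm0' ->.
by apply: contraNN ford => /fm0 ->.
Qed.

Lemma ps_mul_ord f g : f != 0 -> g != 0 ->
  ps_coef (f * g) (ps_ord f + ps_ord g) =
    ps_coef f (ps_ord f) * ps_coef g (ps_ord g)
  /\ forall m, (m < ps_ord f + ps_ord g)%N -> ps_coef (f * g) m = 0.
Proof.
move=> /ps_ord_spec[_ f0] /ps_ord_spec[_ g0]; split=> /=.
  have lt_fn : (ps_ord f < (ps_ord f + ps_ord g).+1)%N by rewrite ltnS leq_addr.
  rewrite (bigD1 (Ordinal lt_fn)) //= addKn big1 ?addr0 // => i.
  rewrite -val_eqE /= neq_ltn => /orP[/f0-> | lt_fi]; first by rewrite mul0r.
  by rewrite [X in _ * X]g0 ?mulr0 // ltn_subLR ?ltn_add2r // -ltnS.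
move=> m lt_m; rewrite big1 // => i _.
have [/f0-> | le_fi] := ltnP i (ps_ord f); first by rewrite mul0r.
rewrite [X in _ * X]g0 ?mulr0 // ltn_subLR; last by rewrite -ltnS.
by apply: leq_trans lt_m _; rewrite leq_add2r.
Qed.

Lemma ps_integral f g : f * g = 0 -> (f == 0) || (g == 0).
Proof.
move=> fg0; apply/norP => -[f_neq0 g_neq0].
have [fgE _] := ps_mul_ord f_neq0 g_neq0.
have [fn _] := ps_ord_spec f_neq0; have [gn _] := ps_ord_spec g_neq0.
move/eqP: fgE; rewrite fg0 /= if_same eq_sym.
by rewrite mulf_eq0 (negPf fn) (negPf gn).
Qed.

HB.instance Definition _ :=
  GRing.ComUnitRing_isIntegral.Build (pseries F) ps_integral.

Lemma ps_ordM f g : f != 0 -> g != 0 -> ps_ord (f * g) = (ps_ord f + ps_ord g)%N.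
Proof.
move=> f_neq0 g_neq0; have [fgE fg0] := ps_mul_ord f_neq0 g_neq0.
apply: ps_ord_eq => //; rewrite fgE mulf_neq0 //.
  by case: (ps_ord_spec f_neq0).
by case: (ps_ord_spec g_neq0).
Qed.

Lemma psC_is_zmod_morphism : zmod_morphism psC.
Proof. by move=> a b; apply: psP => -[|n] //=; rewrite subr0. Qed.
Lemma psC_is_monoid_morphism : monoid_morphism psC.
Proof.
split=> // a b; apply: psP => n /=.
rewrite big_ord_recl /= subn0 big1 => [|i _]; last by rewrite mul0r.
by rewrite addr0; case: n => [|n] //=; rewrite mulr0.
Qed.
HB.instance Definition _ :=
  GRing.isZmodMorphism.Build F (pseries F) psC psC_is_zmod_morphism.
HB.instance Definition _ :=
  GRing.isMonoidMorphism.Build F (pseries F) psC psC_is_monoid_morphism.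

End PowerSeries.

(** * The field F<t^-1> of Laurent series in u = t^-1 *)

Notation laurent F := {fraction (pseries F)}.

Section Laurent.
Variable F : fieldType.

Definition laurentC (a : F) : laurent F := FracField.tofrac (psC a).
Definition laurent_t : laurent F := (FracField.tofrac (psX F))^-1.
Definition polyL (p : {poly F}) : laurent F := (map_poly laurentC p).[laurent_t].

(** The degree in t, i.e. minus the order in u = t^-1; meaningless at 0. *)
Definition laurent_deg (x : laurent F) : int :=
  (ps_ord (\d_(repr x)))%:Z - (ps_ord (\n_(repr x)))%:Z.

HB.instance Definition _ := GRing.RMorphism.copy laurentC
  (@FracField.tofrac (pseries F) \o @psC F).

Lemma polyL_is_zmod_morphism : zmod_morphism polyL.
Proof. by move=> p q; rewrite /polyL rmorphB hornerD hornerN. Qed.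
Lemma polyL_is_monoid_morphism : monoid_morphism polyL.
Proof.
by split=> [|p q]; rewrite /polyL ?rmorph1 ?hornerC // rmorphM hornerM.
Qed.
HB.instance Definition _ :=
  GRing.isZmodMorphism.Build {poly F} (laurent F) polyL polyL_is_zmod_morphism.
HB.instance Definition _ :=
  GRing.isMonoidMorphism.Build {poly F} (laurent F) polyL
    polyL_is_monoid_morphism.

Lemma laurent_fracE (x : laurent F) :
  x = FracField.tofrac \n_(repr x) / FracField.tofrac \d_(repr x).
Proof.
have d_neq0 : \d_(repr x) != 0 by exact: denom_ratioP.
apply: (canRL (mulfK _)); first by rewrite tofrac_eq0.
rewrite -{1}[x]reprK; unlock FracField.tofrac.
rewrite -[LHS]FracField.pi_mul; apply/eqmodP => /=.
rewrite FracField.equivfE /FracField.mulf !numden_Ratio ?mulf_neq0 ?oner_neq0 //.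
by rewrite !mulr1 mulrC.
Qed.

Lemma laurent_deg_frac (f g : pseries F) : f != 0 -> g != 0 ->
  laurent_deg (FracField.tofrac f / FracField.tofrac g)
    = (ps_ord g)%:Z - (ps_ord f)%:Z.
Proof.
move=> f_neq0 g_neq0; set x := _ / _.
have x_neq0 : x != 0 by rewrite mulf_neq0 ?invr_eq0 ?tofrac_eq0.
have d_neq0 : \d_(repr x) != 0 by exact: denom_ratioP.
have n_neq0 : \n_(repr x) != 0.
  by apply: contraNneq x_neq0 => n0; rewrite (laurent_fracE x) n0 tofrac0 mul0r.
have /eqP : FracField.tofrac f / FracField.tofrac g = _ := laurent_fracE x.
rewrite eqr_div ?tofrac_eq0 // -!tofracM tofrac_eq => /eqP/(congr1 (@ps_ord F)).
rewrite !ps_ordM // /laurent_deg => E.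
by apply/eqP; rewrite subr_eq addrAC eq_sym subr_eq -!PoszD addnC -E addnC.
Qed.

Lemma laurent_degM (x y : laurent F) : x != 0 -> y != 0 ->
  laurent_deg (x * y) = laurent_deg x + laurent_deg y.
Proof.
have nz (z : laurent F) : z != 0 -> \n_(repr z) != 0.
  by apply: contraNneq => n0; rewrite (laurent_fracE z) n0 tofrac0 mul0r.
move=> /nz x_neq0 /nz y_neq0.
rewrite {1}(laurent_fracE x) {1}(laurent_fracE y) mulf_div -!tofracM.
rewrite laurent_deg_frac ?mulf_neq0 ?denom_ratioP // !ps_ordM ?denom_ratioP //.
by rewrite !PoszD opprD addrACA.
Qed.

Lemma laurent_deg_t : laurent_deg laurent_t = 1.
Proof.
have oX : ps_ord (psX F) = 1%N.
  by apply: ps_ord_eq => [|[|m]] //=; rewrite oner_neq0.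
have X_neq0 : psX F != 0.
  apply/eqP => /(congr1 (fun f => ps_coef f 1)) /= /eqP.
  by rewrite oner_eq0.
have o1 : ps_ord (1 : pseries F) = 0%N.
  by apply: ps_ord_eq => //=; rewrite oner_neq0.
by rewrite /laurent_t -div1r -tofrac1 laurent_deg_frac ?oner_neq0 // oX o1 subr0.
Qed.

End Laurent.

(** * Cubic function fields *)

Definition pdeg (F : fieldType) (p : {poly F}) : nat := (size p).-1.

Notation ratfun F := {fraction {poly F}}.

Section FunctionField.
Variables (F : finFieldType) (K : fieldExtType (ratfun F)).

Definition polyK (p : {poly F}) : K := (FracField.tofrac p)%:A.
Definition constK (a : F) : K := polyK a%:P.

HB.instance Definition _ := GRing.RMorphism.copy polyK
  (in_alg K \o @FracField.tofrac {poly F}).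
HB.instance Definition _ := GRing.RMorphism.copy constK (polyK \o polyC).

(** [galois] is only available inside a [splittingFieldType], which would make
    K itself normal; normality is therefore stated by the mixin axiom. *)
Definition is_galois : Prop :=
  separable 1%AS {:K}%AS /\ splitting_field_axiom K.

Definition full_constant_field : Prop :=
  forall x : K, algebraicOver constK x -> exists a : F, x = constK a.

Definition OK (x : K) : Prop := integralOver polyK x.

Definition OK_unit (x : K) : Prop := [/\ x != 0, OK x & OK x^-1].

Definition nonconstant_unit (x : K) : Prop :=
  OK_unit x /\ ~ (exists2 a : F, a != 0 & x = constK a).

Definition integral_basis (w : 'I_3 -> K) : Prop :=
  (forall i, OK (w i)) /\
  (forall x : K, OK x ->
     exists! p : {ffun 'I_3 -> {poly F}}, x = \sum_i polyK (p i) * w i).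

(** Generators of O_K^* / F_q^*. *)
Definition fundamental_units (e1 e2 : K) : Prop :=
  [/\ OK_unit e1, OK_unit e2 &
      forall x : K, OK_unit x ->
        exists a : F, exists m n : int,
          a != 0 /\ x = constK a * e1 ^ m * e2 ^ n].

Variable sigma : 'I_3 -> {rmorphism K -> laurent F}.

(** The infinite place splits into three places of K exactly when K has three
    distinct F_q(t)-embeddings into the completion F_q<t^-1> of F_q(t) at
    infinity; the conjugates of x are then the images sigma i x. *)
Definition three_infinite_places : Prop :=
  (forall i (p : {poly F}), sigma i (polyK p) = polyL p) /\
  (forall i j, sigma i =1 sigma j -> i = j).

Definition elt_disc (x : K) : laurent F :=
  \prod_(i < 3) \prod_(j < 3 | (i < j)%N) (sigma i x - sigma j x) ^+ 2.

Definition basis_disc (w : 'I_3 -> K) : laurent F :=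
  (\det (\matrix_(i < 3, j < 3) sigma i (w j))) ^+ 2.

(** D is defined up to squares of F_q^*. *)
Definition is_field_disc (D : {poly F}) : Prop :=
  exists w : 'I_3 -> K, integral_basis w /\ polyL D = basis_disc w.

Definition unit_regulator (e1 e2 : K) (i j : 'I_3) : nat :=
  absz (\det (\matrix_(r < 2, s < 2)
    laurent_deg (sigma (if s == 0 then i else j) (if r == 0 then e1 else e2)))).

(** R is the common value for all systems of fundamental units and all pairs of
    distinct conjugates; the first clause excludes a vacuous second one. *)
Definition is_regulator (R : nat) : Prop :=
  (exists e1 e2, fundamental_units e1 e2) /\
  (forall e1 e2, fundamental_units e1 e2 ->
     forall i j, i != j -> unit_regulator e1 e2 i j = R).

Definition simple_cubic_field (eps : K) (k : F) : Prop :=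
  [/\ \dim {:K} = 3, full_constant_field, three_infinite_places,
      <<1; eps>>%VS = {:K}%VS &
      [/\ k != 0, nonconstant_unit eps & nonconstant_unit (eps + constK k)]].

End FunctionField.

Definition cubic_poly (F : fieldType) (A : {poly F}) (b c : F) :
    {poly {poly F}} :=
  'X^3 - A *: 'X^2 - (A + b%:P) *: 'X - c%:P%:P.

(* Main.v *)
(** Let n = deg A.  Norms of units are constant, so f(-k) is constant, which
    forces k = 1; the cubic then gives eps the degrees (n, 0, -n) and eps + 1 the
    degrees (n, -n, 0) at the infinite places, up to order.  Hence deg D(eps) = 4n
    and deg D(K) >= 2n + 2.  For a nonconstant unit with degrees a >= b >= c,
    a + b + c = 0, D(K) divides its nonzero discriminant, whose degree is at most
    2 (2a + b) = 2 (a - c), so a - c >= n + 1.  But the degree vectors of eps and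
    eps + 1 span n.A_2, and modulo n.A_2 every integer vector of sum 0 has a
    representative with a - c <= n: every unit is thus a constant times a product
    of powers of eps and eps + 1. *)

Require Import Defs.
From HB Require Import structures.
From mathcomp Require Import all_boot all_order all_algebra all_field.
From mathcomp Require Import fraction zify ring.

Set Implicit Arguments.
Unset Strict Implicit.
Unset Printing Implicit Defensive.

Import Order.TTheory GRing.Theory Num.Theory.
Local Open Scope ring_scope.

(** * The degree in t as a non-archimedean valuation on Laurent series *)

Section LaurentDegree.
Variable F : fieldType.
Implicit Types (f g : pseries F) (x y z : laurent F) (p : {poly F}).

Lemma ps_ord_ge f m : f != 0 -> (forall i, (i < m)%N -> ps_coef f i = 0) ->
  (m <= ps_ord f)%N.
Proof.
move=> /ps_ord_spec[f_ord _] f0; rewrite leqNgt.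
by apply: contraNN f_ord => /f0 ->.
Qed.

(** The bound on the order is guarded by [f != 0] because [ps_ord] takes the junk value 0 at the
    zero series. *)
Lemma ps_coef_lt f m i : (f != 0 -> (m <= ps_ord f)%N) -> (i < m)%N ->
  ps_coef f i = 0.
Proof.
have [-> _ _|f_neq0 /(_ isT) le_m lt_i] := eqVneq f 0; first by rewrite /= if_same.
by have [_ ->] := ps_ord_spec f_neq0; last exact: leq_trans le_m.
Qed.

Lemma laurent_num_neq0 x : x != 0 -> \n_(repr x) != 0.
Proof. by apply: contraNneq => n0; rewrite (laurent_fracE x) n0 tofrac0 mul0r. Qed.

(** The ultrametric inequality: over a common denominator, the numerator of the sum vanishes at u =
    0 at least to the smaller of the two orders. The sum must be nonzero, since the degree of 0 is
    meaningless. *)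
Lemma laurent_degD_le x y (m : int) :
  laurent_deg x <= m -> laurent_deg y <= m -> x + y != 0 ->
  laurent_deg (x + y) <= m.
Proof.
have [->|x_neq0] := eqVneq x 0; first by rewrite add0r.
have [->|y_neq0] := eqVneq y 0; first by rewrite addr0.
have := laurent_num_neq0 x_neq0; have := laurent_num_neq0 y_neq0.
move: (laurent_fracE x) (laurent_fracE y); rewrite /laurent_deg.
move: (denom_ratioP (repr x)) (denom_ratioP (repr y)).
set a := \n_(repr x); set d := \d_(repr x); set a' := \n_(repr y).
set d' := \d_(repr y) => d0 d0' xE yE a0' a0 le_x le_y.
have -> : x + y = FracField.tofrac (a * d' + a' * d) / FracField.tofrac (d * d').
  by rewrite xE yE addf_div ?tofrac_eq0 // -!tofracM -tofracD.
move=> s_neq0; have n_neq0 : a * d' + a' * d != 0.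
  by apply: contraNneq s_neq0 => ->; rewrite tofrac0 mul0r.
have := laurent_deg_frac n_neq0 (mulf_neq0 d0 d0').
rewrite {1}/laurent_deg => ->; rewrite ps_ordM //.
have : (minn (ps_ord a + ps_ord d') (ps_ord a' + ps_ord d)
          <= ps_ord (a * d' + a' * d)%R)%N.
  apply: ps_ord_ge => // i lt_i.
  transitivity (ps_coef (a * d') i + ps_coef (a' * d) i) => //.
  by rewrite !(ps_coef_lt (m := i.+1)) ?addr0 // => _; rewrite ps_ordM //; lia.
lia.
Qed.

(** The degree of 1 equals its own double and also twice the degree of -1, so both are 0. *)
Lemma laurent_degN x : laurent_deg (- x) = laurent_deg x.
Proof.
have [->|x_neq0] := eqVneq x 0; first by rewrite oppr0.
have n1 : (-1 : laurent F) != 0 by rewrite oppr_eq0 oner_neq0.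
have := laurent_degM (oner_neq0 _) (oner_neq0 (laurent F)).
have := laurent_degM n1 n1; rewrite mulrNN mulr1 -[- x]mulN1r laurent_degM //.
move: (laurent_deg (-1)) (laurent_deg 1) (laurent_deg x) => u v w; lia.
Qed.

Lemma laurent_degB_le x y (m : int) :
  laurent_deg x <= m -> laurent_deg y <= m -> x - y != 0 ->
  laurent_deg (x - y) <= m.
Proof. by move=> le_x le_y; apply: laurent_degD_le; rewrite ?laurent_degN. Qed.

(** The dominant term decides: if the sum had smaller degree than x, then x = (x + y) - y would
    too. *)
Lemma laurent_degD_lt x y : x != 0 -> laurent_deg y < laurent_deg x ->
  x + y != 0 /\ laurent_deg (x + y) = laurent_deg x.
Proof.
move=> x_neq0 lt_yx; have s_neq0 : x + y != 0.
  apply: contraTneq lt_yx => /eqP; rewrite addr_eq0 => /eqP ->.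
  by rewrite laurent_degN ltxx.
split=> //; apply/eqP; rewrite eq_le laurent_degD_le ?(ltW lt_yx) //=.
rewrite leNgt; apply/negP => lt_sx.
have : laurent_deg (x + y - y) <= Num.max (laurent_deg (x + y)) (laurent_deg y).
  by apply: laurent_degB_le; rewrite ?addrK // le_max lexx ?orbT.
by rewrite addrK le_max !leNgt lt_sx lt_yx.
Qed.

Lemma laurent_degB_max x y : x != 0 -> y != 0 ->
  laurent_deg x != laurent_deg y ->
  x - y != 0 /\ laurent_deg (x - y) = Num.max (laurent_deg x) (laurent_deg y).
Proof.
move=> x0 y0; rewrite neq_lt => /orP[] lt_deg.
  have [d0 dE] := laurent_degD_lt (y := - x) y0 ltac:(by rewrite laurent_degN).
  by rewrite -opprB oppr_eq0 laurent_degN dE max_r ?ltW.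
have [d0 dE] := laurent_degD_lt (y := - y) x0 ltac:(by rewrite laurent_degN).
by rewrite dE max_l ?ltW.
Qed.

Lemma laurent_deg1 : laurent_deg (1 : laurent F) = 0.
Proof.
have := laurent_degM (oner_neq0 _) (oner_neq0 (laurent F)); rewrite mulr1.
by move: (laurent_deg 1) => d; lia.
Qed.

Lemma laurent_degV x : x != 0 -> laurent_deg x^-1 = - laurent_deg x.
Proof.
move=> x_neq0; have := laurent_degM x_neq0 (invr_neq0 x_neq0).
by rewrite divff // laurent_deg1; move: (laurent_deg x) (laurent_deg _) => d d'; lia.
Qed.

Lemma laurent_degX x m : x != 0 -> laurent_deg (x ^+ m) = laurent_deg x * m%:Z.
Proof.
move=> x_neq0; elim: m => [|m IHm]; first by rewrite laurent_deg1 mulr0.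
by rewrite exprS laurent_degM ?expf_neq0 // IHm -[m.+1%:Z]/(1 + m)%:Z PoszD mulrDr mulr1.
Qed.

Lemma laurent_deg_sqr3 x y z : x != 0 -> y != 0 -> z != 0 ->
  laurent_deg (x ^+ 2 * y ^+ 2 * z ^+ 2)
    = (laurent_deg x + laurent_deg y + laurent_deg z) * 2.
Proof.
move=> x0 y0 z0; rewrite -!exprMn laurent_degX ?mulf_neq0 //.
by rewrite (laurent_degM (mulf_neq0 x0 y0) z0) (laurent_degM x0 y0).
Qed.

Lemma laurent_degXz x (m : int) : x != 0 ->
  laurent_deg (x ^ m) = laurent_deg x * m.
Proof.
move=> x_neq0; case: m => m; first exact: laurent_degX.
by rewrite NegzE -exprnN laurent_degV ?expf_neq0 // laurent_degX // mulrN.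
Qed.

Lemma polyL_C (a : F) : polyL a%:P = laurentC a.
Proof. by rewrite /polyL map_polyC hornerC. Qed.

Lemma polyL_X : polyL 'X = laurent_t F.
Proof. by rewrite /polyL map_polyX hornerX. Qed.

Lemma laurentC_neq0 (a : F) : a != 0 -> laurentC a != 0.
Proof. by rewrite fmorph_eq0. Qed.

Lemma laurent_degC (a : F) : a != 0 -> laurent_deg (laurentC a) = 0.
Proof.
move=> a_neq0; rewrite -[laurentC a]divr1 -tofrac1 laurent_deg_frac ?oner_neq0 //; last first.
  by rewrite fmorph_eq0.
by rewrite !(@ps_ord_eq _ _ 0) //= oner_neq0.
Qed.

(** Induction along Horner's scheme p t + a: for p nonzero, p t has degree at least 1 and dominates
    the constant a. *)
Lemma laurent_deg_polyL p : p != 0 ->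
  polyL p != 0 /\ laurent_deg (polyL p) = (pdeg p)%:Z.
Proof.
rewrite /pdeg; elim/poly_ind: p => [|p a IHp]; first by rewrite eqxx.
have t_neq0 : laurent_t F != 0.
  rewrite invr_eq0 tofrac_eq0; apply/eqP => /(congr1 (fun f => ps_coef f 1)) /=.
  exact/eqP/oner_neq0.
have [-> |p_neq0 _] := eqVneq p 0.
  rewrite mul0r add0r polyC_eq0 => a_neq0; rewrite polyL_C laurentC_neq0 //.
  by rewrite laurent_degC // size_polyC a_neq0.
have [q_neq0 q_deg] := IHp p_neq0.
rewrite rmorphD rmorphM /= polyL_X polyL_C size_MXaddC (negPf p_neq0) /=.
have -> : (size p)%:Z = (size p).-1%:Z + 1 by rewrite -size_poly_gt0 in p_neq0; lia.
have degM : laurent_deg (polyL p * laurent_t F) = (size p).-1%:Z + 1.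
  by rewrite laurent_degM // laurent_deg_t q_deg.
have [->|a_neq0] := eqVneq a 0; first by rewrite rmorph0 addr0 mulf_neq0 //; split.
rewrite -degM; apply: laurent_degD_lt; first by rewrite mulf_neq0.
by rewrite laurent_degC // degM; lia.
Qed.

Lemma polyL_inj : injective (@polyL F).
Proof.
move=> p q /eqP; rewrite -subr_eq0 -rmorphB => pq0; apply/eqP; rewrite -subr_eq0.
by apply: contraTT pq0 => /laurent_deg_polyL[].
Qed.

End LaurentDegree.

(** * Conjugates, norms and discriminants of integral elements *)

Lemma fraction_numdenE (R : idomainType) (x : {fraction R}) :
  x = FracField.tofrac \n_(repr x) / FracField.tofrac \d_(repr x).
Proof.
have d_neq0 : \d_(repr x) != 0 by exact: denom_ratioP.
apply: (canRL (mulfK _)); first by rewrite tofrac_eq0.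
rewrite -{1}[x]reprK; unlock FracField.tofrac; rewrite -[LHS]FracField.pi_mul.
apply/eqmodP; rewrite /= FracField.equivfE /FracField.mulf.
by rewrite !numden_Ratio ?mulf_neq0 ?oner_neq0 // !mulr1 mulrC.
Qed.

Local Notation o0 := (@ord0 2).
Local Notation o1 := (lift ord0 (@ord0 1)).
Local Notation o2 := (lift ord0 (lift ord0 (@ord0 0))).

Lemma ord3_cases (i : 'I_3) : [\/ i = o0, i = o1 | i = o2].
Proof.
by case: i => [[|[|[|//]]] lt_i]; [apply: Or31 | apply: Or32 | apply: Or33];
  apply: val_inj.
Qed.

Section Conjugates.
Variables (F : finFieldType) (K : fieldExtType (ratfun F)).
Variable sigma : 'I_3 -> {rmorphism K -> laurent F}.
Hypothesis places : three_infinite_places sigma.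
Implicit Types (x : K) (w : 'I_3 -> K).

Lemma sigma_polyK i p : sigma i (polyK K p) = polyL p.
Proof. by have [->] := places. Qed.

Lemma sigma_constK i a : sigma i (constK K a) = laurentC a.
Proof. by rewrite /constK sigma_polyK polyL_C. Qed.

(** The embeddings are prescribed only on polynomials; clearing the denominator extends their
    agreement to all of F_q(t). *)
Lemma sigma_scalar i j (r : ratfun F) : sigma i r%:A = sigma j r%:A.
Proof.
have d_neq0 : \d_(repr r) != 0 by exact: denom_ratioP.
have E l : sigma l r%:A * polyL \d_(repr r) = polyL \n_(repr r).
  rewrite -!(sigma_polyK l) -rmorphM; congr (sigma l _).
  rewrite /polyK mulr_algl scalerA {1}(fraction_numdenE r) divfK //.
  by rewrite tofrac_eq0.
have [dL_neq0 _] := laurent_deg_polyL d_neq0.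
by apply: (mulIf dL_neq0); rewrite !E.
Qed.

Lemma sigma_eq_primitive x i j :
  <<1; x>>%VS = {:K}%VS -> sigma i x = sigma j x -> i = j.
Proof.
move=> prim_x eq_x; apply: (proj2 places) => y.
have /Fadjoin1_polyP[p ->] : y \in <<1; x>>%VS by rewrite prim_x memvf.
rewrite -!horner_map -!map_poly_comp eq_x /=; congr _.[_].
by apply: eq_map_poly => r; apply: sigma_scalar.
Qed.

(** The degree 3 is prime, so there is no proper intermediate field. *)
Lemma primitive_cubic x : \dim {:K} = 3 -> x \notin 1%VS -> <<1; x>>%VS = {:K}%VS.
Proof.
move=> dimK x_notin1; apply/eqP; rewrite eqEdim subvf /=.
have := field_dimS (subvf <<1%AS; x>>%AS); rewrite dimK.
case/primeP: (isT : prime 3) => _ dvd3 /dvd3 /orP[|/eqP -> //].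
move=> dim1; case/negP: x_notin1.
have /eqP -> : 1%VS == <<1; x>>%VS.
  by rewrite eqEdim (subv_adjoin 1%AS) (eqP dim1) dimv1.
exact: (memv_adjoin 1%AS).
Qed.

Lemma elt_discE x : elt_disc sigma x = (sigma o0 x - sigma o1 x) ^+ 2 *
  (sigma o0 x - sigma o2 x) ^+ 2 * (sigma o1 x - sigma o2 x) ^+ 2.
Proof.
rewrite /elt_disc; under eq_bigr do rewrite big_mkcond /=.
by rewrite !big_ord_recl !big_ord0 /= !(mul1r, mulr1).
Qed.

Lemma elt_disc_eq0 x : elt_disc sigma x = 0 ->
  exists i j, i != j /\ sigma i x = sigma j x.
Proof.
move/eqP/prodf_eq0 => [i _ /prodf_eq0[j lt_ij]].
rewrite expf_eq0 /= subr_eq0 => /eqP eq_ij; exists i, j; split=> //.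
by apply: contraTneq lt_ij => ->; rewrite ltnn.
Qed.

Definition conj_mx w : 'M[laurent F]_3 := \matrix_(i, j) sigma i (w j).

(** The coordinates of the [y j] in the integral basis form a polynomial matrix, and p is its
    determinant. *)
Lemma det_conj_mx w (y : 'I_3 -> K) : integral_basis w -> (forall j, OK (y j)) ->
  exists p, \det (conj_mx y) = \det (conj_mx w) * polyL p.
Proof.
case=> _ w_basis y_OK.
have /fin_all_exists[P PE] j : exists p : {ffun 'I_3 -> {poly F}},
    y j = \sum_i polyK K (p i) * w i.
  by have [p [pE _]] := w_basis _ (y_OK j); exists p.
exists (\det (\matrix_(i, j) P j i)); rewrite -det_map_mx -det_mulmx.
congr (\det _); apply/matrixP => i j; rewrite !mxE PE rmorph_sum.
by apply: eq_bigr => l _; rewrite !mxE rmorphM /= sigma_polyK mulrC.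
Qed.

(** Applied to 1, x, x^2, the change of basis gives a Vandermonde determinant on the left; p is the
    index of x up to sign, possibly 0. *)
Lemma elt_disc_index w x : integral_basis w -> OK x ->
  exists p, elt_disc sigma x = basis_disc sigma w * polyL p ^+ 2.
Proof.
move=> w_basis x_OK.
have [|p pE] := det_conj_mx w_basis (y := fun j => x ^+ j).
  case; elim=> [|j IHj] lt_j; first exact: integral1.
  by rewrite /= exprS; apply: integral_mul => //; apply: IHj; apply: ltnW.
exists p; rewrite -exprMn -pE.
have -> : conj_mx (fun j => x ^+ j) = (Vandermonde 3 (\row_i sigma i x))^T.
  by apply/matrixP => i j; rewrite !mxE rmorphXn.
rewrite det_tr det_Vandermonde -prodrXl; apply: eq_bigr => i _.
by rewrite -prodrXl; apply: eq_bigr => j _; rewrite !mxE -sqrrN opprB.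
Qed.

(** Multiplying the basis by x scales row i of the conjugate matrix by [sigma i x], while the new
    entries [x * w j] stay integral. The norm is thus the determinant of a polynomial matrix. *)
Lemma norm_OK w x : integral_basis w -> \det (conj_mx w) != 0 -> OK x ->
  exists p, \prod_i sigma i x = polyL p.
Proof.
move=> w_basis det_neq0 x_OK.
have [|p pE] := det_conj_mx w_basis (y := fun j => x * w j).
  by move=> j; apply: integral_mul => //; apply: (proj1 w_basis).
exists p; apply: (mulIf det_neq0); rewrite [RHS]mulrC -pE.
have -> : conj_mx (fun j => x * w j) = diag_mx (\row_i sigma i x) *m conj_mx w.
  by apply/matrixP => i j; rewrite mul_diag_mx !mxE rmorphM.
by rewrite det_mulmx det_diag; congr (_ * _); apply: eq_bigr => i _; rewrite mxE.
Qed.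

(** The norms of x and of its inverse are polynomials with product 1, hence constants. *)
Lemma norm_unit w x : integral_basis w -> \det (conj_mx w) != 0 -> OK_unit x ->
  exists2 a : F, a != 0 & \prod_i sigma i x = laurentC a.
Proof.
move=> w_basis det_neq0 [x_neq0 x_OK xV_OK].
have [p pE] := norm_OK w_basis det_neq0 x_OK.
have [q qE] := norm_OK w_basis det_neq0 xV_OK.
have pq1 : p * q = 1.
  apply: polyL_inj; rewrite rmorphM rmorph1 /= -pE -qE -big_split big1 //= => i _.
  by rewrite -rmorphM divff // rmorph1.
have : p \is a GRing.unit by apply/unitrPr; exists q.
rewrite poly_unitE => /andP[/eqP size_p p0_unit].
by exists p`_0; rewrite -?unitfE // pE [p in LHS]size1_polyC ?size_p // polyL_C.
Qed.

Lemma unit_deg_sum w x : integral_basis w -> \det (conj_mx w) != 0 -> OK_unit x ->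
  laurent_deg (sigma o0 x) + laurent_deg (sigma o1 x) + laurent_deg (sigma o2 x) = 0.
Proof.
move=> w_basis det_neq0 x_unit; have [x_neq0 _ _] := x_unit.
have [a a_neq0] := norm_unit w_basis det_neq0 x_unit.
rewrite !big_ord_recl big_ord0 mulr1 => /(congr1 (@laurent_deg F)).
by rewrite laurent_degC // !laurent_degM ?mulf_neq0 ?fmorph_eq0 // addrA.
Qed.

(** All conjugates of a scalar coincide, so its norm is its cube. As this is a constant, x is
    algebraic over F_q. *)
Lemma scalar_unit_const w x : full_constant_field K -> integral_basis w ->
  \det (conj_mx w) != 0 -> OK_unit x -> x \in 1%VS -> exists a, x = constK K a.
Proof.
move=> full w_basis det_neq0 x_unit /vlineP[r xE].
have [a a_neq0] := norm_unit w_basis det_neq0 x_unit.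
rewrite (eq_bigr (fun=> sigma o0 x)); last by move=> i _; rewrite xE (sigma_scalar i o0).
rewrite prodr_const card_ord -(sigma_constK o0) -rmorphXn => /fmorph_inj x3E.
apply: full; exists ('X^3 - a%:P); first by rewrite -size_poly_gt0 size_XnsubC.
by rewrite rmorphB /= map_polyXn map_polyC /root !hornerE x3E subrr.
Qed.

(* For log vectors a >= b >= c with a + b + c = 0, the sum of the pairwise
   maxima is 2a + b = a - c, the spread of the vector. *)
Lemma spread_gt (d0 d1 d2 e01 e02 e12 : int) (n N p : nat) :
  d0 + d1 + d2 = 0 -> (n.*2.+2 <= N)%N ->
  (forall m, d0 <= m -> d1 <= m -> e01 <= m) ->
  (forall m, d0 <= m -> d2 <= m -> e02 <= m) ->
  (forall m, d1 <= m -> d2 <= m -> e12 <= m) ->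
  (e01 + e02 + e12) * 2 = N%:Z + p%:Z * 2 ->
  ~~ [&& `|d0 - d1| <= n%:Z, `|d0 - d2| <= n%:Z & `|d1 - d2| <= n%:Z].
Proof.
move=> sum0 le_N /(_ (Num.max d0 d1)) b01 /(_ (Num.max d0 d2)) b02.
move=> /(_ (Num.max d1 d2)) b12 degE.
have {}b01 : e01 <= Num.max d0 d1 by apply: b01; lia.
have {}b02 : e02 <= Num.max d0 d2 by apply: b02; lia.
have {}b12 : e12 <= Num.max d1 d2 by apply: b12; lia.
apply/negP => /and3P[le01 le02 le12].
lia.
Qed.

(** If the discriminant of x is nonzero, it is D(K) times a nonzero square, so its degree is at
    least 2n + 2; a spread of at most n allows only 2n. Hence the discriminant vanishes and x is
    constant. *)
Lemma unit_const_of_spread w x (DK : {poly F}) (n : nat) : \dim {:K} = 3 ->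
  full_constant_field K -> integral_basis w -> \det (conj_mx w) != 0 ->
  polyL DK = basis_disc sigma w -> (n.*2.+2 <= pdeg DK)%N -> OK_unit x ->
  (forall i j, laurent_deg (sigma i x) - laurent_deg (sigma j x) <= n%:Z) ->
  exists a, x = constK K a.
Proof.
move=> dimK full w_basis det_neq0 DKE le_DK x_unit spread.
have x_OK : OK x by case: x_unit.
have [disc0|disc_neq0] := eqVneq (elt_disc sigma x) 0.
  (* Two conjugates coincide, so x is not primitive and therefore lies in F_q(t). *)
  have [i [j [neq_ij eq_ij]]] := elt_disc_eq0 disc0.
  apply: (scalar_unit_const full w_basis det_neq0 x_unit).
  apply: contraNT neq_ij => /(primitive_cubic dimK) prim_x.
  exact/eqP/(sigma_eq_primitive prim_x).
have sum0 := unit_deg_sum w_basis det_neq0 x_unit.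
have [p discE] := elt_disc_index w_basis x_OK.
move: disc_neq0 (disc_neq0); rewrite {1}discE mulf_eq0 => /norP[].
rewrite -DKE => DK_neq0 p_neq0.
have DK0 : DK != 0 by apply: contraNneq DK_neq0 => ->; rewrite rmorph0.
have p0 : p != 0 by apply: contraNneq p_neq0 => ->; rewrite rmorph0 expr0n.
have [pL0 degp] := laurent_deg_polyL p0; have [_ degDK] := laurent_deg_polyL DK0.
have degD : laurent_deg (elt_disc sigma x) = (pdeg DK)%:Z + (pdeg p)%:Z * 2.
  by rewrite discE -DKE (laurent_degM DK_neq0 p_neq0) laurent_degX // degDK degp.
move: degD; rewrite elt_discE.
set u := sigma o0 x - sigma o1 x; set u' := sigma o0 x - sigma o2 x.
set u'' := sigma o1 x - sigma o2 x => degD.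
rewrite 2!mulf_eq0 !expf_eq0 /= => /norP[/norP[u0 u0'] u0''].
move: degD; rewrite (laurent_deg_sqr3 u0 u0' u0'').
(* The three differences are now known to be nonzero, as the ultrametric bound requires. *)
have b01 m h h' := laurent_degB_le (m := m) h h' u0.
have b02 m h h' := laurent_degB_le (m := m) h h' u0'.
have b12 m h h' := laurent_degB_le (m := m) h h' u0''.
move=> /(spread_gt sum0 le_DK b01 b02 b12).
by case/negP; apply/and3P; split; rewrite ler_norml lerNl opprB !spread.
Qed.

End Conjugates.

(** * The cubic and the degrees of its roots *)

(** Divided differences at the three roots recover Vieta's formulas: [qy] and [qz] are the first
    ones, and their divided difference determines a. *)
Lemma cubic_distinct_roots (L : fieldType) (a b c x y z : L) :
  x != y -> x != z -> y != z ->
  (forall t, t \in [:: x; y; z] -> t ^+ 3 - a * t ^+ 2 - b * t - c = 0) ->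
  forall t, t ^+ 3 - a * t ^+ 2 - b * t - c = (t - x) * (t - y) * (t - z).
Proof.
rewrite -subr_eq0 -(subr_eq0 x z) -(subr_eq0 y z) => xy xz yz r t.
have rx : x ^+ 3 - a * x ^+ 2 - b * x - c = 0 by apply: r; rewrite !inE eqxx.
have ry : y ^+ 3 - a * y ^+ 2 - b * y - c = 0.
  by apply: r; rewrite !inE eqxx orbT.
have rz : z ^+ 3 - a * z ^+ 2 - b * z - c = 0.
  by apply: r; rewrite !inE eqxx !orbT.
have qy : x ^+ 2 + x * y + y ^+ 2 - a * (x + y) - b = 0.
  apply: (mulfI xy); rewrite mulr0 -[RHS](subrr 0) -{1}rx -ry; ring.
have qz : x ^+ 2 + x * z + z ^+ 2 - a * (x + z) - b = 0.
  apply: (mulfI xz); rewrite mulr0 -[RHS](subrr 0) -{1}rx -rz; ring.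
have aE : a = x + y + z.
  apply/eqP; rewrite -subr_eq0 -oppr_eq0; apply/eqP.
  apply: (mulfI yz); rewrite mulr0 -[RHS](subrr 0) -{1}qy -qz; ring.
have bE : b = x ^+ 2 + x * y + y ^+ 2 - a * (x + y).
  by apply/esym/eqP; rewrite -subr_eq0 qy.
have cE : c = x ^+ 3 - a * x ^+ 2 - b * x.
  by apply/esym/eqP; rewrite -subr_eq0 rx.
by rewrite cE bE aE; ring.
Qed.

Lemma horner_cubic_poly (F : fieldType) (L : comNzRingType)
    (phi : {rmorphism {poly F} -> L}) (A : {poly F}) (b c : F) (t : L) :
  (map_poly phi (cubic_poly A b c)).[t]
    = t ^+ 3 - phi A * t ^+ 2 - phi (A + b%:P) * t - phi c%:P.
Proof.
rewrite /cubic_poly !rmorphB /= !map_polyZ /= !map_polyXn map_polyX map_polyC.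
by rewrite !hornerE.
Qed.

(** Only the axioms of a valuation enter, so [deg] is abstract; d stands for the norm of x + 1. The
    root equation fixes deg x, and the two constant norms then leave only two possibilities for y
    and z. *)
Lemma cubic_root_degrees (L : fieldType) (deg : L -> int) (n : int)
    (a b c d x y z : L) :
  deg 1 = 0 -> (forall u, deg (- u) = deg u) ->
  (forall u v, u != 0 -> v != 0 -> deg (u * v) = deg u + deg v) ->
  (forall u v, u != 0 -> deg v < deg u -> u + v != 0 /\ deg (u + v) = deg u) ->
  0 < n -> a != 0 -> deg a = n -> b != 0 -> deg b = n ->
  c != 0 -> deg c = 0 -> d != 0 -> deg d = 0 ->
  x ^+ 3 - a * x ^+ 2 - b * x - c = 0 ->
  x * y * z = c -> (x + 1) * (y + 1) * (z + 1) = d -> 0 < deg x ->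
  [/\ deg x = n, deg (x + 1) = n &
    [/\ deg y = 0, deg z = - n,
        deg (y + 1) = - n & deg (z + 1) = 0] \/
    [/\ deg y = - n, deg z = 0,
        deg (y + 1) = 0 & deg (z + 1) = - n]].
Proof.
move=> deg1 degN degM degD_lt n_gt0 a0 dega b0 degb c0 degc d0 degd rootx prodE prod1E x_gt0.
have := c0; rewrite -prodE !mulf_eq0 => /norP[/norP[x0 y0] z0].
have := d0; rewrite -prod1E !mulf_eq0 => /norP[/norP[x10 y10] z10].
have eqx : x ^+ 2 * (x - a) = b * x + c.
  by apply/eqP; rewrite -subr_eq0 -rootx; apply/eqP; ring.
have bx0 : b * x != 0 by rewrite mulf_neq0.
have degbx : deg (b * x) = n + deg x.
  by rewrite (degM _ _ b0 x0) degb.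
have [rhs0 degR] : b * x + c != 0 /\ deg (b * x + c) = n + deg x.
  rewrite -degbx; apply: degD_lt => //.
  by rewrite degc degbx addr_gt0.
have degL : deg x *+ 2 + deg (x - a) = n + deg x.
  rewrite -degR -eqx; move: rhs0; rewrite -eqx mulf_eq0 => /norP[x20 xa0].
  by rewrite (degM _ _ x20 xa0) expr2 (degM _ _ x0 x0).
(* Compare degrees in x^2 (x - a) = b x + c. If deg x < n, then deg (x - a) = n forces deg x = 0; if
   deg x > n, then 3 deg x = n + deg x, which is also impossible. *)
have degx : deg x = n.
  have [lt_xn|lt_nx|//] := ltgtP (deg x) n.
    have [_] : a - x != 0 /\ deg (a - x) = deg (a).
      by apply: degD_lt; rewrite ?degN ?dega.
    rewrite -degN opprB dega => degxA.
    by move: degL x_gt0 n_gt0; rewrite degxA; move: (deg x) => e; clear -n e; lia.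
  have [_ degxA] : x - a != 0 /\ deg (x - a) = deg x.
    by apply: degD_lt; rewrite ?degN ?dega.
  by move: degL x_gt0 n_gt0 lt_nx; rewrite degxA; move: (deg x) => e; clear -n e; lia.
have degD1 (t : L) : 0 < deg t -> t != 0 ->
    deg (t + 1) = deg t.
  by move=> t_gt0 t0; have [|_ ->] := degD_lt t 1 t0; rewrite ?deg1.
have degD1' (t : L) : deg t < 0 -> deg (t + 1) = 0.
  move=> t_lt0; rewrite addrC.
  by have [|_ ->] := degD_lt 1 t (oner_neq0 L); rewrite ?deg1.
have degx1 : deg (x + 1) = n by rewrite degD1.
have degyz : deg y + deg z = - n.
  move/(congr1 (deg)): prodE.
  rewrite (degM _ _ (mulf_neq0 x0 y0) z0) (degM _ _ x0 y0) degc degx.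
  by move: (deg y) (deg z) => e e'; clear -n e e'; lia.
have degyz1 : deg (y + 1) + deg (z + 1) = - n.
  move/(congr1 (deg)): prod1E.
  rewrite (degM _ _ (mulf_neq0 x10 y10) z10) (degM _ _ x10 y10) degd degx1.
  by move: (deg (y + 1)) (deg (z + 1)) => e e'; clear -n e e'; lia.
have degB1 (t : L) : t != 0 -> deg (t + 1) < 0 -> deg t = 0.
  move=> t0 t1_lt0; have [|t_lt0|//] := ltgtP (deg t) 0.
    by move/degD1' => E; move: t1_lt0; rewrite E.
  by move: t1_lt0; rewrite degD1 // ltNge ltW.
split=> //.
(* As deg y + deg z = -n, one of the two is negative. Adding 1 to that root gives degree 0, so the
   other root plus 1 has degree -n, which forces that other root to have degree 0. *)
have [z_lt0|z_ge0] := ltP (deg z) 0.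
  left; have degz1 := degD1' z z_lt0.
  have degy1 : deg (y + 1) = - n by move: degyz1; rewrite degz1 addr0.
  have degy : deg y = 0 by apply: degB1 => //; rewrite degy1 oppr_lt0.
  by split=> //; move: degyz; rewrite degy add0r.
have y_lt0 : deg y < 0.
  by move: degyz z_ge0 n_gt0; move: (deg y) (deg z) => e e'; clear -n e e'; lia.
right; have degy1 := degD1' y y_lt0.
have degz1 : deg (z + 1) = - n by move: degyz1; rewrite degy1 add0r.
have degz : deg z = 0 by apply: degB1 => //; rewrite degz1 oppr_lt0.
by split=> //; move: degyz; rewrite degz addr0.
Qed.

(** * Reduction of degree vectors modulo n times the A_2 lattice *)

(* After reducing the coordinates mod n their sum is 0, n or 2n; in the last two
   cases n is subtracted from the largest one, resp. from all but the smallest. *)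
Lemma spread_reduction (n : nat) (v0 v1 v2 : int) : (0 < n)%N ->
  v0 + v1 + v2 = 0 -> exists p q r : int, p + q + r = 0 /\
  [/\ `|(v0 - n%:Z * p) - (v1 - n%:Z * q)| <= n%:Z,
      `|(v0 - n%:Z * p) - (v2 - n%:Z * r)| <= n%:Z &
      `|(v1 - n%:Z * q) - (v2 - n%:Z * r)| <= n%:Z].
Proof.
move=> n_gt0 sum0; have n_neq0 : n%:Z != 0 by lia.
have E v : v - n%:Z * (v %/ n%:Z)%Z = (v %% n%:Z)%Z.
  by rewrite {1}(divz_eq v n%:Z); ring.
have lb v := modz_ge0 v n_neq0.
have ub v : (v %% n%:Z)%Z < n%:Z by apply: ltz_pmod.
move: (E v0) (E v1) (E v2) (lb v0) (lb v1) (lb v2) (ub v0) (ub v1) (ub v2).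
move: (v0 %/ _)%Z (v1 %/ _)%Z (v2 %/ _)%Z => p q r.
move: (v0 %% _)%Z (v1 %% _)%Z (v2 %% _)%Z => a b c aE bE cE.
move=> a_ge0 b_ge0 c_ge0 a_lt b_lt c_lt.
have sumE : a + b + c = - (n%:Z * (p + q + r)).
  by rewrite -aE -bE -cE -[RHS]add0r -sum0; ring.
have step v t e : v - n%:Z * t = e -> v - n%:Z * (t + 1) = e - n%:Z.
  by move=> <-; ring.
have [s0|s1|s2] : [\/ p + q + r = 0, p + q + r = -1 | p + q + r = -2].
  have : -3 < p + q + r <= 0 by nia.
  by case: (p + q + r) => [[|s]|[|[|s]]] // _;
    [apply: Or31 | apply: Or32 | apply: Or33].
- by exists p, q, r; rewrite aE bE cE; split=> //; split; lia.
- have [[ba ca]|[ab cb]|[ac bc]] :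
    [\/ b <= a /\ c <= a, a <= b /\ c <= b | a <= c /\ b <= c].
    by case: (leP a b); case: (leP b c); case: (leP a c) => ? ? ?;
      first [apply: Or31; lia | apply: Or32; lia | apply: Or33; lia].
  + exists (p + 1), q, r; rewrite (step _ _ _ aE) bE cE.
    by split; [lia | split; lia].
  + exists p, (q + 1), r; rewrite aE (step _ _ _ bE) cE.
    by split; [lia | split; lia].
  + exists p, q, (r + 1); rewrite aE bE (step _ _ _ cE).
    by split; [lia | split; lia].
- have [[ba ca]|[ab cb]|[ac bc]] :
    [\/ a <= b /\ a <= c, b <= a /\ b <= c | c <= a /\ c <= b].
    by case: (leP a b); case: (leP b c); case: (leP a c) => ? ? ?;
      first [apply: Or31; lia | apply: Or32; lia | apply: Or33; lia].
  + exists p, (q + 1), (r + 1); rewrite aE (step _ _ _ bE) (step _ _ _ cE).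
    by split; [lia | split; lia].
  + exists (p + 1), q, (r + 1); rewrite (step _ _ _ aE) bE (step _ _ _ cE).
    by split; [lia | split; lia].
  + exists (p + 1), (q + 1), r; rewrite (step _ _ _ aE) (step _ _ _ bE) cE.
    by split; [lia | split; lia].
Qed.

(** * The unit group, the regulator and a criterion for fundamental units *)

Section Units.
Variables (F : finFieldType) (K : fieldExtType (ratfun F)).
Variable sigma : 'I_3 -> {rmorphism K -> laurent F}.
Hypothesis places : three_infinite_places sigma.
Implicit Types x y : K.

Lemma OK_unitM x y : OK_unit x -> OK_unit y -> OK_unit (x * y).
Proof.
move=> [x0 xO xVO] [y0 yO yVO]; split; first by rewrite mulf_neq0.
  exact: integral_mul.
by rewrite invfM; apply: integral_mul.
Qed.

Lemma OK_unitV x : OK_unit x -> OK_unit x^-1.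
Proof. by case=> x0 xO xVO; split; rewrite ?invr_eq0 ?invrK. Qed.

Lemma OK_unitXz x (m : int) : OK_unit x -> OK_unit (x ^ m).
Proof.
move=> xU; have X n : OK_unit (x ^+ n).
  elim: n => [|n IHn]; last by rewrite exprS; apply: OK_unitM.
  by split; rewrite ?invr1 ?oner_neq0 //; apply: integral1.
by case: m => n; [apply: X | rewrite NegzE -exprnN; apply/OK_unitV/X].
Qed.

Lemma laurent_deg_sigmaM i x y : x != 0 -> y != 0 ->
  laurent_deg (sigma i (x * y)) = laurent_deg (sigma i x) + laurent_deg (sigma i y).
Proof. by move=> x0 y0; rewrite rmorphM laurent_degM // fmorph_eq0. Qed.

Lemma laurent_deg_sigmaXz i x (m : int) : x != 0 ->
  laurent_deg (sigma i (x ^ m)) = laurent_deg (sigma i x) * m.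
Proof. by move=> x0; rewrite fmorphXz laurent_degXz // fmorph_eq0. Qed.

Lemma laurent_deg_sigma_const i (a : F) : a != 0 ->
  laurent_deg (sigma i (constK K a)) = 0.
Proof. by move=> a0; rewrite (sigma_constK places) laurent_degC. Qed.

Lemma unit_regulatorE x y i j : unit_regulator sigma x y i j =
  absz (laurent_deg (sigma i x) * laurent_deg (sigma j y)
        - laurent_deg (sigma j x) * laurent_deg (sigma i y))%R.
Proof.
rewrite /unit_regulator (expand_det_row _ ord0) !big_ord_recl big_ord0 /=.
by rewrite /cofactor !det_mx11 !mxE /= addr0 expr0 mul1r expr1 mulN1r mulrN.
Qed.

(** Expressing x and y through e1 and e2 multiplies the determinant of degrees by the integer
    determinant of the exponents. Mutual divisibility then makes the regulator independent of the
    fundamental system. *)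
Lemma unit_regulator_dvd e1 e2 x y i j : fundamental_units e1 e2 ->
  OK_unit x -> OK_unit y ->
  (unit_regulator sigma e1 e2 i j %| unit_regulator sigma x y i j)%N.
Proof.
move=> [[e10 _ _] [e20 _ _] gen] /gen[a [m [n [a0 ->]]]] /gen[a' [m' [n' [a0' ->]]]].
have degE l b p q : b != 0 ->
    laurent_deg (sigma l (constK K b * e1 ^ p * e2 ^ q))
      = laurent_deg (sigma l e1) * p + laurent_deg (sigma l e2) * q.
  move=> b0; have bK0 : constK K b != 0 by rewrite fmorph_eq0.
  have p0 := expfz_neq0 p e10; have q0 := expfz_neq0 q e20.
  rewrite (laurent_deg_sigmaM l (mulf_neq0 bK0 p0) q0) (laurent_deg_sigmaM l bK0 p0).
  by rewrite laurent_deg_sigma_const // !laurent_deg_sigmaXz // add0r.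
rewrite !unit_regulatorE !degE //.
move: (laurent_deg _) (laurent_deg _) (laurent_deg _) (laurent_deg _) => d1 d2 d3 d4.
set v : int := (X in (absz X %| _)%N); set u : int := (X in (_ %| absz X)%N).
suff -> : u = v * (m * n' - m' * n) by rewrite abszM dvdn_mulr.
by rewrite /u /v; ring.
Qed.

Lemma regulator_unique e1 e2 x y i j : fundamental_units e1 e2 ->
  fundamental_units x y -> unit_regulator sigma x y i j = unit_regulator sigma e1 e2 i j.
Proof.
move=> eF xF; have [e1U e2U _] := eF; have [xU yU _] := xF.
by apply/eqP; rewrite eqn_dvd !unit_regulator_dvd.
Qed.

(** The degree vectors (n, 0, -n) and (n, -n, 0) span n times A_2, so any unit can be moved to
    spread at most n, where [const] applies. The places are named abstractly so that they can be
    permuted. *)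
Lemma fundamental_units_of_logs (n : nat) e1 e2 i0 i1 i2 : (0 < n)%N ->
  (forall l, [\/ l = i0, l = i1 | l = i2]) -> OK_unit e1 -> OK_unit e2 ->
  (forall x, OK_unit x -> laurent_deg (sigma i0 x) + laurent_deg (sigma i1 x)
     + laurent_deg (sigma i2 x) = 0) ->
  (forall x, OK_unit x ->
     (forall l m, laurent_deg (sigma l x) - laurent_deg (sigma m x) <= n%:Z) ->
     exists a, x = constK K a) ->
  laurent_deg (sigma i0 e1) = n%:Z -> laurent_deg (sigma i1 e1) = 0 ->
  laurent_deg (sigma i2 e1) = - n%:Z ->
  laurent_deg (sigma i0 e2) = n%:Z -> laurent_deg (sigma i1 e2) = - n%:Z ->
  laurent_deg (sigma i2 e2) = 0 ->
  fundamental_units e1 e2 /\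
  forall l m, l != m -> unit_regulator sigma e1 e2 l m = (n ^ 2)%N.
Proof.
move=> n_gt0 all3 e1U e2U sum0 const d10 d11 d12 d20 d21 d22; split; last first.
  move=> l m; rewrite unit_regulatorE -mulnn.
  by case: (all3 l) => ->; case: (all3 m) => ->;
    rewrite ?eqxx // ?d10 ?d11 ?d12 ?d20 ?d21 ?d22 => _; nia.
split=> // x xU; have [e10 _ _] := e1U; have [e20 _ _] := e2U.
have [x0 _ _] := xU.
have [p [q [r [pqr [s01 s02 s12]]]]] := spread_reduction n_gt0 (sum0 x xU).
(* Since p = -q - r, multiplying by e1^r e2^q subtracts exactly n (p, q, r) from the degree vector
   of x. *)
have r0 := expfz_neq0 r e10; have q0 := expfz_neq0 q e20.
have degE l : laurent_deg (sigma l (x * e1 ^ r * e2 ^ q)) = laurent_deg (sigma l x)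
    + laurent_deg (sigma l e1) * r + laurent_deg (sigma l e2) * q.
  rewrite (laurent_deg_sigmaM l (mulf_neq0 x0 r0) q0) (laurent_deg_sigmaM l x0 r0).
  by rewrite !laurent_deg_sigmaXz.
have yU : OK_unit (x * e1 ^ r * e2 ^ q) by do !apply: OK_unitM => //; apply: OK_unitXz.
have [|a aE] := const _ yU.
  have pE : p = - q - r by apply/eqP; rewrite -opprD -addr_eq0 addrA pqr.
  have D0 := degE i0; have D1 := degE i1; have D2 := degE i2.
  rewrite d10 d20 in D0; rewrite d11 d21 in D1; rewrite d12 d22 in D2.
  rewrite pE in s01 s02.
  move: s01 s02 s12 D0 D1 D2.
  move: (laurent_deg (sigma i0 x)) (laurent_deg (sigma i1 x)) (laurent_deg (sigma i2 x)).
  move=> v0 v1 v2 s01 s02 s12 D0 D1 D2 l m.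
  have E0 : laurent_deg (sigma i0 (x * e1 ^ r * e2 ^ q)) = v0 - n%:Z * (- q - r).
    by rewrite D0; ring.
  have E1 : laurent_deg (sigma i1 (x * e1 ^ r * e2 ^ q)) = v1 - n%:Z * q.
    by rewrite D1; ring.
  have E2 : laurent_deg (sigma i2 (x * e1 ^ r * e2 ^ q)) = v2 - n%:Z * r.
    by rewrite D2; ring.
  apply: le_trans (ler_norm _) _.
  by case: (all3 l) => ->; case: (all3 m) => ->;
    rewrite ?E0 ?E1 ?E2 ?subrr ?normr0 // distrC.
have a0 : a != 0.
  by have [y0 _ _] := yU; apply: contraNneq y0 => a0; rewrite aE a0 rmorph0.
exists a, (- r), (- q); split=> //; rewrite -aE -!invr_expz.
by rewrite mulrAC (mulfK q0) (mulfK r0).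
Qed.

End Units.

(** * Application to the given cubic *)

(** Three elements of degrees n, 0, -n have pairwise differences of degrees n, n, 0. *)
Lemma laurent_deg_disc (F : fieldType) (n : int) (x y z : laurent F) : 0 < n ->
  x != 0 -> y != 0 -> z != 0 -> laurent_deg x = n ->
  laurent_deg y = 0 /\ laurent_deg z = - n \/ laurent_deg y = - n /\ laurent_deg z = 0 ->
  laurent_deg ((x - y) ^+ 2 * (x - z) ^+ 2 * (y - z) ^+ 2) = n * 4.
Proof.
move=> n_gt0 x0 y0 z0 degx degyz.
have [xy xz yz] : [/\ laurent_deg x != laurent_deg y, laurent_deg x != laurent_deg z
    & laurent_deg y != laurent_deg z].
  by case: degyz => -[-> ->]; rewrite degx; split; clear -n_gt0; lia.
have [u0 uE] := laurent_degB_max x0 y0 xy.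
have [v0 vE] := laurent_degB_max x0 z0 xz.
have [t0 tE] := laurent_degB_max y0 z0 yz.
rewrite (laurent_deg_sqr3 u0 v0 t0) uE vE tE degx.
by case: degyz => -[-> ->]; clear -n_gt0; lia.
Qed.

Lemma pdegM (F : fieldType) (p q : {poly F}) : p != 0 -> q != 0 ->
  pdeg (p * q) = (pdeg p + pdeg q)%N.
Proof.
move=> p0 q0; rewrite /pdeg size_mul //; move: p0 q0; rewrite -!size_poly_gt0.
by case: (size p) (size q) => [|m] [|n] //; rewrite addSn addnS.
Qed.

Lemma prod_shift (R : comNzRingType) (x y z s t : R) :
  t = (- s - x) * (- s - y) * (- s - z) -> (x + s) * (y + s) * (z + s) = - t.
Proof. by move=> ->; ring. Qed.

Lemma rmorph_cubic (R S : comNzRingType) (phi : {rmorphism R -> S}) (s a b c : R) :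
  phi (- ((- s) ^+ 3 - a * (- s) ^+ 2 - b * (- s) - c))
    = - ((- phi s) ^+ 3 - phi a * (- phi s) ^+ 2 - phi b * (- phi s) - phi c).
Proof. by rewrite !(rmorphN, rmorphXn, rmorphD, rmorphM). Qed.

(** The right-hand side is -f(-k), whose only nonconstant term is k (k - 1) A. *)
Lemma shift_eq1 (F : fieldType) (A : {poly F}) (a b c k : F) :
  (1 <= pdeg A)%N -> k != 0 ->
  a%:P = - ((- k%:P) ^+ 3 - A * (- k%:P) ^+ 2 - (A + b%:P) * (- k%:P) - c%:P) ->
  k = 1.
Proof.
move=> degA k0 aE.
have E : (k * (k - 1))%:P * A = (a - k ^+ 3 + b * k - c)%:P.
  by rewrite !(rmorphM, rmorphB, rmorphD, rmorphXn) /= aE rmorph1; ring.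
apply/eqP; rewrite -subr_eq0; apply: contraTT degA => k1.
have kk0 : k * (k - 1) != 0 by rewrite mulf_neq0.
have -> : pdeg A = pdeg ((k * (k - 1))%:P * A) by rewrite /pdeg mul_polyC size_scale.
by rewrite E /pdeg size_polyC; case: eqP.
Qed.

Theorem theorem4p5 (F : finFieldType)
  (charF : forall p : nat, p \in [pchar F] -> (5 <= p)%N)
  (K : fieldExtType (ratfun F))
  (sigma : 'I_3 -> {rmorphism K -> laurent F})
  (A : {poly F}) (b c k : F) (eps : K) (I DK : {poly F})
  (degA : (1 <= pdeg A)%N)
  (c_neq0 : c != 0)
  (simpleK : simple_cubic_field sigma eps k)
  (nonGalK : ~ is_galois K)
  (minpoly_eps : minPoly 1%AS eps = map_poly (@polyK F K) (cubic_poly A b c))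
  (deg_eps : 0 < laurent_deg (sigma ord0 eps))
  (discK : is_field_disc sigma DK)
  (indexI : elt_disc sigma eps = polyL (I ^+ 2 * DK))
  (degI : (pdeg I <= pdeg A - 1)%N) :
  is_regulator sigma (pdeg A ^ 2)
  /\ fundamental_units eps (eps + constK K k).
Proof.
have [dimK full places prim_eps [k0 [epsU _] [eps1U _]]] := simpleK.
have [w [w_basis DKE]] := discK.
have disc_neq0 : elt_disc sigma eps != 0.
  apply/eqP => /elt_disc_eq0[i [j [/eqP neq_ij]]].
  by move/(sigma_eq_primitive places prim_eps).
(* D(eps) is I^2 D(K), and D(K) is the square of this determinant. *)
have det_neq0 : \det (conj_mx sigma w) != 0.
  apply: contraNneq disc_neq0 => det0; rewrite indexI rmorphM /= DKE /basis_disc.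
  by rewrite -/(conj_mx sigma w) det0 expr0n mulr0.
have rootE i : sigma i eps ^+ 3 - polyL A * sigma i eps ^+ 2
    - polyL (A + b%:P) * sigma i eps - polyL c%:P = 0.
  rewrite -horner_cubic_poly; have := minPolyxx 1%AS eps; rewrite minpoly_eps.
  move/(congr1 (sigma i)); rewrite rmorph0 -horner_map -map_poly_comp.
  by rewrite (eq_map_poly (sigma_polyK places i)).
have neq_sigma i j : i != j -> sigma i eps != sigma j eps.
  by apply: contra_neq => /(sigma_eq_primitive places prim_eps).
set x := sigma o0 eps in rootE deg_eps *; set y := sigma o1 eps; set z := sigma o2 eps.
have factE t : t ^+ 3 - polyL A * t ^+ 2 - polyL (A + b%:P) * t - polyL c%:P
    = (t - x) * (t - y) * (t - z).
  apply: cubic_distinct_roots t; rewrite ?neq_sigma // => t.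
  by rewrite !inE => /or3P[] /eqP ->; apply: rootE.
(* Evaluating the factored cubic at -s: the norm of eps + s is -f(-s). *)
have normE s : (x + laurentC s) * (y + laurentC s) * (z + laurentC s) =
    polyL (- ((- s%:P) ^+ 3 - A * (- s%:P) ^+ 2 - (A + b%:P) * (- s%:P) - c%:P)).
  by rewrite -polyL_C (prod_shift (factE _)) rmorph_cubic.
have k1 : k = 1.
  have [a _] := norm_unit places w_basis det_neq0 eps1U.
  rewrite !big_ord_recl big_ord0 mulr1 mulrA !rmorphD /= !(sigma_constK places).
  rewrite normE -polyL_C => /polyL_inj/esym; exact: shift_eq1.
have kE i : sigma i (eps + constK K k) = sigma i eps + 1.
  by rewrite rmorphD /= (sigma_constK places) k1 rmorph1.
have degC (a : F) : a != 0 -> polyL a%:P != 0 /\ laurent_deg (polyL a%:P) = 0.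
  by move=> a0; rewrite polyL_C laurentC_neq0 // laurent_degC.
have A0 : A != 0 by apply: contraTneq degA => ->; rewrite /pdeg size_poly0.
have pdegAb : pdeg (A + b%:P) = pdeg A.
  rewrite /pdeg size_polyDl // size_polyC; apply: leq_ltn_trans (leq_b1 _) _.
  by move: degA; rewrite /pdeg; case: (size A).
have Ab0 : A + b%:P != 0.
  by apply: contraTneq degA => Ab0; rewrite -pdegAb Ab0 /pdeg size_poly0.
have [AL0 ALdeg] := laurent_deg_polyL A0.
have [AbL0] := laurent_deg_polyL Ab0; rewrite pdegAb => AbLdeg.
have [cL0 cLdeg] := degC c c_neq0.
have [a a0 aE] := norm_unit places w_basis det_neq0 eps1U.
move: aE; rewrite !big_ord_recl big_ord0 mulr1 mulrA !kE => aE.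
have prodE : x * y * z = polyL c%:P.
  have := normE 0; rewrite rmorph0 !addr0 => ->; congr polyL.
  by rewrite !polyC0; ring.
have n_gt0 : 0 < (pdeg A)%:Z by [].
have [degx degx1 degyz] := cubic_root_degrees (laurent_deg1 F) (@laurent_degN F)
  (@laurent_degM F) (@laurent_degD_lt F) n_gt0 AL0 ALdeg AbL0 AbLdeg cL0 cLdeg
  (laurentC_neq0 a0) (laurent_degC a0) (rootE o0) prodE aE deg_eps.
have [eps0 _ _] := epsU.
(* From 4n = 2 deg I + deg D(K) and deg I at most n - 1. *)
have degDK : ((pdeg A).*2.+2 <= pdeg DK)%N.
  have sn0 i : sigma i eps != 0 by rewrite fmorph_eq0.
  have degD : laurent_deg (elt_disc sigma eps) = (pdeg A)%:Z * 4.
    rewrite elt_discE.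
    apply: (laurent_deg_disc n_gt0 (sn0 o0) (sn0 o1) (sn0 o2) degx).
    by case: degyz => -[yE zE _ _]; [left | right].
  have := disc_neq0; rewrite indexI => IDL0.
  have ID0 : I ^+ 2 * DK != 0 by apply: contraNneq IDL0 => ->; rewrite rmorph0.
  have := ID0; rewrite mulf_eq0 expf_eq0 /= => /norP[I0 DK0].
  have [_] := laurent_deg_polyL ID0; rewrite -indexI degD.
  have -> : pdeg (I ^+ 2 * DK) = ((pdeg I).*2 + pdeg DK)%N.
    by rewrite (pdegM (expf_neq0 2 I0) DK0) expr2 (pdegM I0 I0) addnn.
  by clear -degI degA; lia.
have const u uU := unit_const_of_spread places dimK full w_basis det_neq0 DKE
  degDK (x := u) uU.
have sum0 u uU := unit_deg_sum places w_basis det_neq0 (x := u) uU.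
suff [fund regE] : fundamental_units eps (eps + constK K k) /\ forall l m, l != m ->
    unit_regulator sigma eps (eps + constK K k) l m = (pdeg A ^ 2)%N.
  split=> //; split=> [|e1 e2 eF i j neq_ij]; first by exists eps, (eps + constK K k).
  by rewrite (regulator_unique places i j fund eF) regE.
case: degyz => -[degy degz degy1 degz1].
  have := fundamental_units_of_logs degA ord3_cases epsU eps1U sum0 const
    degx degy degz.
  by rewrite !kE; apply.
(* In the remaining case the places [o1] and [o2] exchange roles. *)
have ord3_cases' (l : 'I_3) : [\/ l = o0, l = o2 | l = o1].
  by case: (ord3_cases l) => ->; [apply: Or31 | apply: Or33 | apply: Or32].
have sum0' u : OK_unit u -> laurent_deg (sigma o0 u) + laurent_deg (sigma o2 u)
    + laurent_deg (sigma o1 u) = 0.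
  by move=> uU; rewrite addrAC sum0.
have := fundamental_units_of_logs degA ord3_cases' epsU eps1U sum0' const
  degx degz degy.
by rewrite !kE; apply.
Qed.
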